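(* For real $b$ and nonnegative integers $n$ let $$H_n(b,x)=\det\left(\binom{x+i+j}{2j}+b\binom{x+i+j}{2j+1}\right)_{i,j=0}^{n-1}$$ (a polynomial in $x$, with $H_0(b,x)=1$). Then for every nonnegative integer $n$, as polynomials in $x$, $$H_n(2,x)=2^nH_n\left(1,x-\tfrac12\right)=\prod_{j=0}^{\lfloor\frac{n-1}{2}\rfloor}\ \prod_{i=2j+1}^{2n-2j-1}\frac{2x+i}{i}.$$
   Context: For a polynomial variable $y$ and integer $m\ge0$, $\binom{y}{m}=\frac{y(y-1)\cdots(y-m+1)}{m!}$. Empty products and the determinant of a $0\times0$ matrix equal $1$. *)

(* Defs.v *)
From HB Require Import structures.
From mathcomp Require Import all_boot all_order all_algebra.

Set Implicit Arguments.
Unset Strict Implicit.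
Unset Printing Implicit Defensive.

Import Order.TTheory GRing.Theory Num.Theory.
Local Open Scope ring_scope.

Definition binp (R : realFieldType) (y : {poly R}) (m : nat) : {poly R} :=
  (m`!)%:R^-1 *: \prod_(k < m) (y - k%:R).

Definition Hpoly (R : realFieldType) (n : nat) (b : R) : {poly R} :=
  \det (\matrix_(i < n, j < n)
    (binp ('X + i%:R + j%:R) (2 * j) +
     b *: binp ('X + i%:R + j%:R) (2 * j + 1))).

(* The index j ranges over 0, ..., floor((n-1)/2), where floor(-1/2) = -1;
   there are floor((n+1)/2) such indices, including none for n = 0.  For each
   of them 2j+1 <= 2n-2j-1, so the subtractions below do not truncate. *)
Definition rhs_prod (R : realFieldType) (n : nat) : {poly R} :=
  \prod_(0 <= j < n.+1./2)
    \prod_((2 * j).+1 <= i < 2 * n - 2 * j) (i%:R^-1 *: (2 *: 'X + i%:R)).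

(* Main.v *)
Require Import Defs.
From mathcomp Require Import all_boot all_order all_algebra.
From mathcomp Require Import ring zify.
Import GRing.Theory Num.Theory.
Local Open Scope ring_scope.

(** Up to the factor [(2j+1)!], the [(i,j)] entry of either matrix is
    [2x + 2i + 1] times a monic polynomial of degree [j] in [(x + i + 1/2)^2],
    or equivalently in [(x + i)(x + i + 1)], because the factors of the binomial
    coefficients are symmetric about [x + i + 1/2]. Both determinants are
    therefore the same multiple of the Vandermonde determinant of these squares,
    whose factors are [(k - i)(2x + i + k + 1)]. This product telescopes to
    [\prod_(k < n) \prod_(k < i < 2k + 2) (2x + i) / i], a rearrangement of the
    stated right-hand side. *)

(** The matrix factors as diagonal times transposed Vandermonde times [U] times diagonal. Column [j]
    of [U] lists the coefficients of the monic polynomial of degree [j] with roots [b k], so [U] is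
    upper triangular with unit diagonal. *)
Lemma det_scaled_prod_sub (A : comNzRingType) (n : nat) (r c a b : nat -> A) :
  \det (\matrix_(i < n, j < n) (r i * c j * \prod_(k < j) (a i - b k))) =
  (\prod_(i < n) r i) * (\prod_(i < n) c i) *
  \prod_(k < n) \prod_(i < k) (a k - a i).
Proof.
pose p j : {poly A} := \prod_(0 <= k < j) ('X - (b k)%:P).
have p_monic j : p j \is monic by exact: monic_prod_XsubC.
have p_size j : size (p j) = j.+1.
  by rewrite size_prod_XsubC size_iota subn0.
have p_eval j x : \prod_(k < j) (x - b k) = (p j).[x].
  by rewrite horner_prod big_mkord; apply: eq_bigr=> k _; rewrite !hornerE.
pose V := Vandermonde n (\row_(i < n) a i).
pose U : 'M[A]_n := \matrix_(k, j) (p j)`_k.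
have -> : \matrix_(i < n, j < n) (r i * c j * \prod_(k < j) (a i - b k)) =
    diag_mx (\row_(i < n) r i) *m (V^T *m U) *m diag_mx (\row_(i < n) c i).
  apply/matrixP=> i j; rewrite mul_mx_diag mul_diag_mx !mxE mulrAC.
  congr (_ * _ * _); rewrite p_eval (@horner_coef_wide _ n) ?p_size//.
  by apply: eq_bigr=> k _; rewrite !mxE mulrC.
have detU : \det U = 1.
  rewrite -det_tr det_trig.
    apply: big1=> i _; rewrite !mxE.
    by have /monicP := p_monic i; rewrite /lead_coef p_size.
  by apply/is_trig_mxP=> i j lt_ij; rewrite !mxE nth_default// p_size.
rewrite !det_mulmx !det_diag det_tr detU mulr1 det_Vandermonde mulrAC.
congr (_ * _ * _); do ?by apply: eq_bigr=> i _; rewrite mxE.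
rewrite (exchange_big_dep xpredT)//=; apply: eq_bigr=> k _.
rewrite (big_ord_widen n (fun i => a k - a i)); last exact: ltnW.
by apply: eq_bigr=> i _; rewrite !mxE.
Qed.

(** Passing from [j] to [j + 1] adds one factor at each end, and
    [(t + j + 1)(t - j) = t(t + 1) - j(j + 1)]. *)
Lemma prod_centered_even (A : comNzRingType) (t : A) (j : nat) :
  \prod_(k < 2 * j) (t + j%:R - k%:R) =
  \prod_(k < j) (t * (t + 1) - k%:R * (k%:R + 1)).
Proof.
elim: j => [|j IHj]; first by rewrite !big_ord0.
rewrite [RHS]big_ord_recr/= -IHj mulnS big_ord_recl big_ord_recr/=.
rewrite /bump/= !add1n.
have -> : \prod_(i < 2 * j) (t + j.+1%:R - (1 + i)%N%:R) =
          \prod_(k < 2 * j) (t + j%:R - k%:R).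
  by apply: eq_bigr=> i _; ring.
by ring.
Qed.

(** The central factor is [t]; the others pair up as [(t + k + 1)(t - k - 1)]. *)
Lemma prod_centered_odd (A : comNzRingType) (t : A) (j : nat) :
  \prod_(k < (2 * j).+1) (t + j%:R - k%:R) =
  t * \prod_(k < j) (t ^+ 2 - (k%:R + 1) ^+ 2).
Proof.
elim: j => [|j IHj]; first by rewrite muln0 big_ord1 big_ord0 /=; ring.
rewrite [in RHS]big_ord_recr/= mulrA -IHj mulnS add2n [LHS]big_ord_recl [X in _ * X = _]big_ord_recr/=.
rewrite /bump/= ?add1n.
have -> : \prod_(i < (2 * j).+1) (t + j.+1%:R - (1 + i)%N%:R) =
          \prod_(k < (2 * j).+1) (t + j%:R - k%:R).
  by apply: eq_bigr=> i _; ring.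
by ring.
Qed.

Lemma prod_pairs_down (A : comNzRingType) (f : nat -> A) (n m : nat) :
  (m <= n)%N ->
  \prod_(0 <= j < m) (f (2 * n - 2 * j)%N * f (2 * n - 2 * j).+1) =
  \prod_((2 * n - 2 * m).+2 <= i < (2 * n).+2) f i.
Proof.
elim: m => [|m IHm] le_mn; first by rewrite big_geq// big_geq ?subn0.
rewrite big_nat_recr//= (IHm (ltnW le_mn)).
rewrite [RHS]big_ltn; last lia.
rewrite [X in _ = _ * X]big_ltn; last lia.
have -> : ((2 * n - 2 * m.+1).+2 = 2 * n - 2 * m)%N by lia.
by rewrite mulrC mulrA.
Qed.

(** Induction on [n]: each existing row [j] on the left gains [f] at [2n - 2j] and [2n - 2j + 1].
    These pairs fill a contiguous range ending at [2n + 1], to be matched with the new layer from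
    [n + 1] to [2n + 1] on the right. *)
Lemma prod_triangle_rearrange (A : comNzRingType) (f : nat -> A) (n : nat) :
  \prod_(0 <= j < n.+1./2) \prod_((2 * j).+1 <= i < 2 * n - 2 * j) f i =
  \prod_(0 <= k < n) \prod_(k.+1 <= i < (2 * k).+2) f i.
Proof.
elim: n => [|n IHn]; first by rewrite !big_geq.
rewrite [RHS]big_nat_recr// -IHn.
have step j : (j < n.+1./2)%N ->
    \prod_((2 * j).+1 <= i < 2 * n.+1 - 2 * j) f i =
    \prod_((2 * j).+1 <= i < 2 * n - 2 * j) f i *
      (f (2 * n - 2 * j)%N * f (2 * n - 2 * j).+1).
  move=> lt_j; have -> : (2 * n.+1 - 2 * j = (2 * n - 2 * j).+2)%N by lia.
  by rewrite !big_nat_recr/= ?mulrA//; lia.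
have steps : \prod_(0 <= j < n.+1./2) \prod_((2 * j).+1 <= i < 2 * n.+1 - 2 * j) f i =
    \prod_(0 <= j < n.+1./2) \prod_((2 * j).+1 <= i < 2 * n - 2 * j) f i *
    \prod_((2 * n - 2 * n.+1./2).+2 <= i < (2 * n).+2) f i.
  rewrite -prod_pairs_down; last lia.
  by rewrite -big_split/= !big_nat; apply: eq_bigr=> j /andP[_]; exact: step.
have [n_odd|n_even] := boolP (odd n).
  (* For odd [n] no row is added, and the pairs already start at [n + 1]. *)
  have -> : n.+2./2 = n.+1./2 by lia.
  rewrite steps; congr (_ * _); congr (\prod_(_ <= i < _) f i); lia.
(* For even [n] the pairs start at [n + 2]; the missing [f n.+1] is the whole of the new row
   [j = h = n/2]. *)
have [h hE] : {h | h = n.+1./2} by exists n.+1./2.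
have -> : n.+2./2 = h.+1 by lia.
rewrite -hE in steps *; rewrite big_nat_recr//= steps -mulrA; congr (_ * _).
rewrite mulrC [RHS]big_ltn; last lia.
have -> : (2 * n.+1 - 2 * h = n.+2)%N by lia.
have -> : ((2 * h).+1 = n.+1)%N by lia.
have -> : ((2 * n - 2 * h).+2 = n.+2)%N by lia.
by rewrite big_nat1.
Qed.

Lemma prod_sub_nat (A : comNzRingType) (k : nat) :
  \prod_(i < k) (k%:R - i%:R) = k`!%:R :> A.
Proof.
rewrite fact_prod natr_prod big_add1/= big_mkord (reindex_inj rev_ord_inj)/=.
by apply: eq_bigr=> i _; rewrite -natrB ?leq_subr// subKn.
Qed.

(** The differences [k - i] multiply to [k!], and [k!/(2k+1)!] supplies the denominators [k + 1] to
    [2k + 1]. The separate linear factor is the top one, [i = 2k + 1]. *)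
Lemma prod_layer (R : realFieldType) (k : nat) :
  (2 * 'X + (2 * k).+1%:R) * (((2 * k).+1)`!%:R^-1)%:P *
    \prod_(i < k) ((k%:R - i%:R) * (2 * 'X + (k + i).+1%:R)) =
  \prod_(k.+1 <= i < (2 * k).+2) (i%:R^-1 *: (2 *: 'X + i%:R)) :> {poly R}.
Proof.
rewrite scaler_prod big_split/= prod_sub_nat.
have -> : \prod_(k.+1 <= i < (2 * k).+2) i%:R^-1 = k`!%:R / ((2 * k).+1)`!%:R :> R.
  rewrite (@fact_split (2 * k).+1 k); last lia.
  by rewrite natrM natr_prod prodfV invfM mulrA mulfV ?mul1r// pnatr_eq0 -lt0n fact_gt0.
rewrite big_nat_recr/=; last lia.
rewrite -[X in \prod_(X <= i < _) _](add0n k.+1) big_addn.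
have -> : ((2 * k).+1 - k.+1 = k)%N by lia.
rewrite big_mkord -[RHS]mul_polyC polyCM polyC_natr.
have -> : 2 *: 'X = 2 * 'X :> {poly R} by rewrite scaler_nat mulr_natl.
have -> : \prod_(i < k) (2 * 'X + (k + i).+1%:R) =
          \prod_(i < k) (2 * 'X + (i + k.+1)%:R) :> {poly R}.
  by apply: eq_bigr=> i _; congr (_ + _%:R); lia.
by ring.
Qed.

(** The value depends on [a] only through its differences, so one evaluation serves both
    determinants. *)
Lemma det_scaled_quadratic_eval (R : realFieldType) (n : nat) (a b : nat -> {poly R}) :
  (forall k i, a k - a i = (k%:R - i%:R) * (2 * 'X + (k + i).+1%:R)) ->
  \det (\matrix_(i < n, j < n)
    ((2 * 'X + (2 * i).+1%:R) * (((2 * j).+1)`!%:R^-1)%:P *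
     \prod_(k < j) (a i - b k))) = rhs_prod R n.
Proof.
move=> a_sub; rewrite /rhs_prod prod_triangle_rearrange big_mkord.
rewrite (det_scaled_prod_sub _ _ (fun i => 2 * 'X + (2 * i).+1%:R)
  (fun j => (((2 * j).+1)`!%:R^-1)%:P)).
rewrite -!big_split/=; apply: eq_bigr=> k _; rewrite -prod_layer.
by congr (_ * _); apply: eq_bigr=> i _.
Qed.

Lemma binp_add_scaled (R : realFieldType) (y : {poly R}) (b : R) (m : nat) :
  binp y m + b *: binp y (m + 1) =
  (m.+1`!%:R^-1)%:P * ((m.+1%:R + b%:P * (y - m%:R)) * \prod_(k < m) (y - k%:R)).
Proof.
rewrite /binp addn1 big_ord_recr/= factS natrM invfM -!mul_polyC polyCM.
have e : (m.+1%:R^-1)%:P * m.+1%:R = 1 :> {poly R}.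
  by rewrite -polyC_natr -polyCM mulVf// pnatr_eq0.
rewrite -[X in X + _]mul1r -[X in X * _ + _]e; ring.
Qed.

Lemma binp_comp (R : realFieldType) (y q : {poly R}) (m : nat) :
  binp y m \Po q = binp (y \Po q) m.
Proof.
rewrite /binp comp_polyZ rmorph_prod; congr (_ *: _).
by apply: eq_bigr=> k _; rewrite rmorphB rmorph_nat.
Qed.

Lemma Hpoly2E (R : realFieldType) (n : nat) : Hpoly n (2 : R) = rhs_prod R n.
Proof.
rewrite -(@det_scaled_quadratic_eval R n (fun i => ('X + i%:R) * ('X + i%:R + 1))
  (fun k => k%:R * (k%:R + 1))); last by move=> k i; ring.
(* With [b = 2] and [y = x + i + j], the linear factor [2j + 1 + b(y - 2j)] equals [2x + 2i + 1];
   the remaining product is centered with [t = x + i]. *)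
congr (\det _); apply/matrixP=> i j; rewrite !mxE binp_add_scaled.
by rewrite -prod_centered_even polyC_natr; ring.
Qed.

Lemma Hpoly1_shiftE (R : realFieldType) (n : nat) :
  2 ^+ n *: (Hpoly n (1 : R) \Po ('X - (2^-1)%:P)) = rhs_prod R n.
Proof.
have half : 2 * (2^-1)%:P = 1 :> {poly R}.
  by rewrite -polyC_natr -polyCM mulfV// pnatr_eq0.
(* From here on, one half is an abstract [h] known only by [2 * h = 1], which keeps the [ring] goals
   free of inverses of 2. *)
move: (2^-1)%:P half => h half.
pose s i : {poly R} := 'X + i%:R + h.
have sE i : s i = 'X + i%:R - h + 1 by rewrite /s -[X in _ = _ + X]half; ring.
rewrite -(@det_scaled_quadratic_eval R n (fun i => s i ^+ 2) (fun k => (k%:R + 1) ^+ 2)).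
  rewrite -det_map_mx -mul_polyC rmorphXn/= -detZ.
  congr (\det _); apply/matrixP=> i j; rewrite !mxE.
  rewrite scale1r comp_polyD !binp_comp -[X in _ + X]scale1r binp_add_scaled.
  rewrite !comp_polyD comp_polyX -!polyC_natr !comp_polyC !polyC_natr.
  have -> : 2 * 'X + (2 * i).+1%:R = 2 * s i.
    by rewrite /s mulrDr half; ring.
  have -> : 2 * s i * (((2 * j).+1)`!%:R^-1)%:P *
      \prod_(k < j) (s i ^+ 2 - (k%:R + 1) ^+ 2) =
      2 * (((2 * j).+1)`!%:R^-1)%:P * \prod_(k < (2 * j).+1) (s i + j%:R - k%:R).
    by rewrite prod_centered_odd; ring.
  (* With [b = 1] the linear factor is [y + 1 = s i + j], where [y] is the shifted argument: it is
     the [k = 0] factor of the odd centered product. *)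
  rewrite big_ord_recl/=.
  have -> : \prod_(k < 2 * j) (s i + j%:R - (bump 0 k)%:R) =
            \prod_(k < 2 * j) ('X - h + i%:R + j%:R - k%:R).
    by apply: eq_bigr=> k _; rewrite sE /bump/=; ring.
  by rewrite sE; ring.
move=> k i; transitivity ((k%:R - i%:R) * (2 * 'X + (k + i)%:R + 2 * h)).
  by rewrite /s; ring.
by rewrite half; ring.
Qed.

Theorem theorem5 (R : realFieldType) (n : nat) :
  Hpoly n (2 : R) = 2 ^+ n *: (Hpoly n (1 : R) \Po ('X - (2^-1)%:P)) /\
  2 ^+ n *: (Hpoly n (1 : R) \Po ('X - (2^-1)%:P)) = rhs_prod R n.
Proof. by rewrite Hpoly2E Hpoly1_shiftE. Qed.
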